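(* Let $R$ be a semidistributive (left) nearring with an identity. Then the additive group $R^+=(R,+)$ of $R$ is abelian.
   Context: A (left) nearring is a set $R$ with two binary operations $+$ and $\cdot$ such that (1) $(R,+)$ is a (not necessarily abelian) group with neutral element $0$; (2) $(R,\cdot)$ is a semigroup; (3) $x\cdot(y+z)=x\cdot y+x\cdot z$ for all $x,y,z\in R$. It is not assumed that $0\cdot x=0$. The group $R^+=(R,+)$ is called the additive group of $R$. The nearring $R$ is a nearring with identity if the semigroup $(R,\cdot)$ is a monoid, i.e. it has a two-sided identity element $i$. A nearring $R$ is called semidistributive if $(r+s+r)t=rt+st+rt$ for all $r,s,t\in R$. *)

(* Defs.v *)
From HB Require Import structures.
From mathcomp Require Import all_boot.

Set Implicit Arguments.
Unset Strict Implicit.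
Unset Printing Implicit Defensive.

(* MathComp's Z-modules and semirings all have a commutative addition, so a
   nearring is built here from the law-free operations of [baseZmodType]
   (+, 0, -) and [magmaType] (product), over an arbitrary carrier: the library's
   [groupType] and [semigroupType] would also demand a [choiceType]. *)

Declare Scope nearring_scope.
Delimit Scope nearring_scope with NR.
Notation "x + y" := (@Algebra.add _ x y) : nearring_scope.
Notation "x * y" := (@monoid.mul _ x y) : nearring_scope.
Local Open Scope nearring_scope.

(* The axioms of [isGroup], written additively. *)
HB.mixin Record BaseZmodule_isAddGroup V of Algebra.BaseZmodule V := {
  nr_addA : associative (@Algebra.add V);
  nr_add0x : left_id Algebra.zero (@Algebra.add V);
  nr_addx0 : right_id Algebra.zero (@Algebra.add V);
  nr_addNx : left_inverse Algebra.zero Algebra.opp (@Algebra.add V);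
  nr_addxN : right_inverse Algebra.zero Algebra.opp (@Algebra.add V)
}.

#[short(type="addGroupType")]
HB.structure Definition AddGroup :=
  {V of BaseZmodule_isAddGroup V & Algebra.BaseZmodule V}.

(* Left nearrings; the law [0 * x = 0] is not assumed. *)
HB.mixin Record AddGroup_isNearring R of AddGroup R & Magma R := {
  nr_mulA : associative (@monoid.mul R);
  nr_mulDr : forall x y z : R, x * (y + z) = x * y + x * z
}.

#[short(type="nearringType")]
HB.structure Definition Nearring :=
  {R of AddGroup_isNearring R & AddGroup R & Magma R}.

Definition has_identity (R : nearringType) : Prop :=
  exists i : R, left_id i (@monoid.mul R) /\ right_id i (@monoid.mul R).

Definition semidistributive (R : nearringType) : Prop :=
  forall r s t : R, (r + s + r) * t = r * t + s * t + r * t.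

Definition add_abelian (V : addGroupType) : Prop :=
  commutative (@Algebra.add V).

(* Main.v *)
Require Import Defs.
From HB Require Import structures.
From mathcomp Require Import all_boot.

(** The map [x |-> 0 * x] is additive and idempotent, so every [x] splits as
    [a + k] with [a] in its image and [k] in its kernel. The theorem follows once
    these two parts commute elementwise, each with itself and with the other.

    Everything comes from one identity. Expanding [(r + s + r) * (t + u)] first
    by left distributivity and then by semidistributivity, or the other way
    round, and cancelling gives
      [s t + r t + r u + s u = r u + s t + s u + r t]   ([exchange]).
    Three specializations suffice. With [r = 1] and [s = 0] it makes the kernel
    commutative. The image has exponent 2, because semidistributivity at
    [r = s = 0] gives [0 t = 0 t + 0 t + 0 t]; hence it is commutative as well.
    Finally [r = t = 1], with [s = k] in the kernel and [u = a] in the image,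
    gives [a + k + a = k] ([kernel_fixed_by_image]), that is [a + k = k + a].

    Right multiplication by [n 1] alone cannot suffice: it only says that
    [n (r + s + r) = n r + n s + n r], which holds in every group of
    nilpotency class 2. The products [k * a] are what is needed. *)

Local Open Scope nearring_scope.
Local Notation "0" := (@Algebra.zero _) : nearring_scope.

Lemma add_cancell (V : addGroupType) (x y z : V) : x + y = x + z -> y = z.
Proof.
move=> /(congr1 (fun w => Algebra.opp x + w)).
by rewrite !nr_addA nr_addNx !nr_add0x.
Qed.

Lemma add_cancelr (V : addGroupType) (x y z : V) : y + x = z + x -> y = z.
Proof.
move=> /(congr1 (fun w => w + Algebra.opp x)).
by rewrite -!nr_addA nr_addxN !nr_addx0.
Qed.

Lemma mul_zeror (R : nearringType) (x : R) : x * 0 = 0.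
Proof.
by apply: (@add_cancell _ (x * 0)); rewrite -nr_mulDr !nr_addx0.
Qed.

Lemma zero_mul_idem (R : nearringType) (x : R) : 0 * (0 * x) = 0 * x.
Proof. by rewrite nr_mulA mul_zeror. Qed.

Section Semidistributive.

Set Implicit Arguments.
Unset Strict Implicit.

Variable R : nearringType.
Hypothesis hsd : semidistributive R.

Lemma exchange (r s t u : R) :
  s * t + r * t + r * u + s * u = r * u + s * t + s * u + r * t.
Proof.
have := hsd r s (t + u); rewrite nr_mulDr !hsd !nr_mulDr -!nr_addA.
move=> /add_cancell; rewrite !nr_addA => /add_cancelr //.
Qed.

Lemma zero_mul_double (t : R) : 0 * t + 0 * t = 0.
Proof.
apply: (@add_cancelr _ (0 * t)).
by rewrite -hsd !nr_add0x.
Qed.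

Lemma image_comm (x y : R) : 0 * x + 0 * y = 0 * y + 0 * x.
Proof.
apply: (@add_cancelr _ (0 * x + 0 * y)).
rewrite -nr_mulDr zero_mul_double nr_mulDr -nr_addA (nr_addA (0 * x)).
by rewrite zero_mul_double nr_add0x zero_mul_double.
Qed.

(** The kernel part of [x] is [- (0 * x) + x], and [0 * x] is its own
    opposite. *)
Lemma kernel_part (x : R) : 0 * (0 * x + x) = 0.
Proof. by rewrite nr_mulDr zero_mul_idem zero_mul_double. Qed.

Lemma image_kernel_split (x : R) : x = 0 * x + (0 * x + x).
Proof. by rewrite nr_addA zero_mul_double nr_add0x. Qed.

Variable i : R.
Hypothesis mul1x : left_id i (@monoid.mul R).
Hypothesis mulx1 : right_id i (@monoid.mul R).

Lemma kernel_comm (k l : R) : 0 * k = 0 -> 0 * l = 0 -> k + l = l + k.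
Proof.
move=> hk hl; have := exchange i 0 k l.
by rewrite !mul1x hk hl !nr_addx0 nr_add0x.
Qed.

(** For [k] in the kernel, [k * a] has the same image part as [a], since
    [0 * (k * a) = (0 * k) * a = 0 * a = a]. So [k * a = a + m] with [m] in the
    kernel, and the specialization [k + 1 + a + k a = a + k + k a + 1] of the
    exchange identity becomes [k + 1 + m = (a + k + a) + m + 1], where the
    kernel elements [1] and [m] commute and cancel. *)
Lemma kernel_fixed_by_image (a k : R) :
  0 * a = a -> 0 * k = 0 -> a + k + a = k.
Proof.
move=> ha hk.
have aa : a + a = 0 by rewrite -ha zero_mul_double.
have [m ka hm] : exists2 m, k * a = a + m & 0 * m = 0.
  exists (a + k * a); first by rewrite nr_addA aa nr_add0x.
  by rewrite nr_mulDr nr_mulA hk ha.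
have := exchange i k i a.
rewrite !mul1x !mulx1 ka -(nr_addA (k + i)) (nr_addA a a) aa nr_add0x.
rewrite -(nr_addA k) (kernel_comm (mulx1 _) hm) !nr_addA.
by move=> /add_cancelr /add_cancelr /esym.
Qed.

Lemma image_kernel_comm (a k : R) : 0 * a = a -> 0 * k = 0 -> a + k = k + a.
Proof.
move=> ha hk; rewrite -{2}(kernel_fixed_by_image ha hk) -nr_addA.
by rewrite -{4}ha -{3}ha zero_mul_double nr_addx0.
Qed.

End Semidistributive.

Theorem lemma4 (R : nearringType) (hid : has_identity R)
  (hsd : semidistributive R) : add_abelian R.
Proof.
case: hid => i [mul1x mulx1] x y.
rewrite (image_kernel_split hsd x) (image_kernel_split hsd y).
have hk := kernel_part hsd x; have hl := kernel_part hsd y.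
have ha := zero_mul_idem R x; have hb := zero_mul_idem R y.
have hab := image_comm hsd x y.
move: (0 * x) (0 * x + x) (0 * y) (0 * y + y) hk hl ha hb hab.
move=> a k b l hk hl ha hb hab.
have comm := image_kernel_comm hsd mul1x mulx1.
rewrite -(nr_addA a) (nr_addA k) -(comm b k) // -(nr_addA b k) nr_addA hab.
rewrite (kernel_comm hsd mul1x hk hl) -(nr_addA b a) (nr_addA a l) (comm a l) //.
by rewrite !nr_addA.
Qed.
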